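(* In the setting described in the context (a simple algebraic extension $(L|K,v)$ with $vL=vK$, a complete sequence of key polynomials $\{Q_i(\eta)\}_{i\in I}$ for it, and the associated final segments $\alpha,\beta$ of $\Gamma_\infty$), assume that the $\mathcal{O}_L$-module homomorphism $\Omega\to I_\alpha/I_\beta$ sending $d\tilde Q_i(\eta)$ to $Q_i'(\eta)/a_i+I_\beta$ for $i\in I$ is an isomorphism. Then the annihilator of $\Omega$ is $I_\gamma\cap\mathcal{O}_L$, where $$\gamma=\{\beta'\in\Gamma\mid \beta'+\alpha\subseteq\beta\}.$$
   Context: Let $(L|K,v)$ be a simple algebraic extension of valued fields with $vL=vK$, written $L=K(\eta)$, and let $g\in K[x]$ be the minimal polynomial of $\eta$ over $K$. $\mathcal{O}_L,\mathcal{O}_K$ are the valuation rings, $\Gamma=vL$, $\Gamma_\infty=\Gamma\cup\{\infty\}$, and $\Omega$ is the $\mathcal{O}_L$-module of Kähler differentials of $\mathcal{O}_L|\mathcal{O}_K$. For $S\subseteq\Gamma_\infty$, $I_S=\{b\in L\mid \exists s\in S:\ vb\ge s\}$, an $\mathcal{O}_L$-submodule of $L$ (with $I_\emptyset=\{0\}$). Let $\nu(f)=v(f(\eta))$ for $f\in K[x]$; fix an extension of $\nu$ to $\overline K[x]$, again denoted $\nu$. For $f\in K[x]\setminus K$ put $\delta(f)=\max\{\nu(x-a)\mid f(a)=0\}$. A monic polynomial $Q\in K[x]\setminus K$ is a key polynomial for $\nu$ if for every $f\in K[x]\setminus K$, $\delta(f)\ge\delta(Q)$ implies $\deg f\ge\deg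 Q$. For non-constant $q$ and $q$-expansion $f=f_0+\ldots+f_rq^r$ ($\deg f_\ell<\deg q$), $\nu_q(f)=\min_\ell\nu(f_\ell q^\ell)$. A set of non-constant polynomials is complete for $\nu$ if for every non-constant $f\in K[x]$ it contains some $q$ with $\deg q\le\deg f$ and $\nu_q(f)=\nu(f)$. Let $\{Q_i\}_{i\in I}\cup\{g\}$ be a complete set of key polynomials for $\nu$, with $I$ well-ordered with initial element $0$, $i<j\Rightarrow\delta(Q_i)<\delta(Q_j)$, $\nu(Q_i)<\infty$ for all $i\in I$, $Q_0=x$ and $\nu(x)=0$ (one then says $\{Q_i(\eta)\}_{i\in I}$ is a complete sequence of key polynomials for $(L|K,v)$). For each $i\in I$ choose $a_i\in K$ with $v(a_i)=\nu(Q_i)$ (with $a_0=1$) and put $\tilde Q_i=Q_i/a_i$. With $f'$ the formal derivative, put $\alpha_i=\nu(Q_i')-\nu(Q_i)$ and $\beta_i=\nu(g')-\nu_{Q_i}(g)$ in $\Gamma_\infty$, and let $\alpha$, $\beta$ be the smallest final segments of $\Gamma_\infty$ containing $\{\alpha_i\mid i\in I\}$ and $\{\beta_i\mid i\in I\}$, respectively. *)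

(* Defs.v *)
From HB Require Import structures.
From mathcomp Require Import all_boot all_order all_algebra all_field.
From mathcomp Require Import generic_quotient ring_quotient.
From mathcomp Require Import boolp classical_sets wochoice.

Set Implicit Arguments.
Unset Strict Implicit.
Unset Printing Implicit Defensive.

Import Order.TTheory GRing.Theory Num.Theory.
Local Open Scope ring_scope.
Local Open Scope quotient_scope.

HB.mixin Record isOrderedAbelian G of Num.POrderedZmodule G := {
  oag_le_total : total (<=%R : rel G);
  oag_leD2l : forall z x y : G, x <= y -> z + x <= z + y
}.

#[short(type="oagType")]
HB.structure Definition OrderedAbelian :=
  { G of Num.POrderedZmodule G & isOrderedAbelian G }.

Definition winfty (G : Type) : Type := option G.
Notation fin := (@Some _ : _ -> winfty _).
Notation infty := (@None _ : winfty _).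

Section Winfty.
Variable G : oagType.

HB.instance Definition _ := Choice.on (winfty G).

Definition winfty_le (x y : winfty G) : bool :=
  match x, y with
  | _, None => true
  | None, Some _ => false
  | Some a, Some b => a <= b
  end.

Definition winfty_add (x y : winfty G) : winfty G :=
  match x, y with
  | Some a, Some b => Some (a + b)
  | _, _ => None
  end.

(* [x - y] is only meaningful for finite [y]. *)
Definition winfty_sub (x y : winfty G) : winfty G :=
  match x, y with
  | Some a, Some b => Some (a - b)
  | _, _ => None
  end.

Fact winfty_le_refl : reflexive winfty_le.
Proof. by case=> [a|] /=. Qed.

Fact winfty_le_anti : antisymmetric winfty_le.
Proof. by case=> [a|] [b|] //= /le_anti ->. Qed.

Fact winfty_le_trans : transitive winfty_le.
Proof. by case=> [a|] [b|] [c|] //=; apply: le_trans. Qed.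

Fact winfty_le_total : total winfty_le.
Proof. by case=> [a|] [b|] //=; apply: oag_le_total. Qed.

HB.instance Definition _ :=
  Order.Le_isPOrder.Build ring_display (winfty G)
    winfty_le_refl winfty_le_anti winfty_le_trans.
HB.instance Definition _ :=
  Order.POrder_isTotal.Build ring_display (winfty G) winfty_le_total.

Fact winfty_addA : associative winfty_add.
Proof. by case=> [a|] [b|] [c|] //=; rewrite addrA. Qed.

Fact winfty_addC : commutative winfty_add.
Proof. by case=> [a|] [b|] //=; rewrite addrC. Qed.

Fact winfty_add0 : left_id (Some 0) winfty_add.
Proof. by case=> [a|] //=; rewrite add0r. Qed.

HB.instance Definition _ :=
  GRing.isNmodule.Build (winfty G) winfty_addA winfty_addC winfty_add0.

Lemma winfty_leE (x y : winfty G) : (x <= y) = winfty_le x y.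
Proof. by []. Qed.

Lemma winfty_leD2l (z x y : winfty G) : x <= y -> z + x <= z + y.
Proof.
by rewrite !winfty_leE; case: z x y => [c|] [a|] [b|] //=; apply: oag_leD2l.
Qed.

Definition final_segment (S : set (winfty G)) : Prop :=
  forall s t : winfty G, S s -> s <= t -> S t.

End Winfty.

(* The support [v^-1(infty)] may be a nonzero prime ideal; it is zero as soon
   as [R] is a field (see [val_eqinfty]). *)
Record valuation (R : comNzRingType) (G : oagType) := Valuation {
  valf :> R -> winfty G;
  val_0 : valf 0 = infty;
  val_1 : valf 1 = 0;
  val_M : forall x y, valf (x * y) = valf x + valf y;
  val_D : forall x y, Order.min (valf x) (valf y) <= valf (x + y)
}.

Lemma val_eqinfty (F : fieldType) (G : oagType) (v : valuation F G) (x : F) :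
  v x = infty <-> x = 0.
Proof.
split=> [vx|->]; last exact: val_0.
apply/eqP; apply: contraT => x0.
by have := val_1 v; rewrite -(divff x0) val_M vx.
Qed.

Lemma val_N (R : comNzRingType) (G : oagType) (v : valuation R G) (x : R) :
  v (- x) = v x.
Proof.
suff v1 : v (-1) = 0 by rewrite -mulN1r val_M v1 add0r.
have : v (-1) + v (-1) = 0 by rewrite -val_M mulrNN mulr1 val_1.
case: (v (-1)) => [a|] //= [aa]; congr Some.
case/orP: (oag_le_total 0 a) => a0; apply/le_anti.
  by rewrite a0 andbT -aa -[leLHS]addr0; apply: oag_leD2l.
by rewrite a0 /= -aa -[leRHS]addr0; apply: oag_leD2l.
Qed.

Section Restriction.
Variables (R S : comNzRingType) (G : oagType).
Variables (f : {rmorphism R -> S}) (v : valuation S G).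

Fact restr_val0 : v (f 0) = infty. Proof. by rewrite rmorph0 val_0. Qed.
Fact restr_val1 : v (f 1) = 0. Proof. by rewrite rmorph1 val_1. Qed.
Fact restr_valM x y : v (f (x * y)) = v (f x) + v (f y).
Proof. by rewrite rmorphM val_M. Qed.
Fact restr_valD x y : Order.min (v (f x)) (v (f y)) <= v (f (x + y)).
Proof. by rewrite rmorphD val_D. Qed.

Definition restr_val : valuation R G :=
  Valuation restr_val0 restr_val1 restr_valM restr_valD.

End Restriction.

Definition value_group (R : comNzRingType) (G : oagType) (v : valuation R G) :
    set G :=
  [set c | exists x : R, v x = fin c]%classic.

Section ValuationRing.
Variables (R : comNzRingType) (G : oagType) (v : valuation R G).

Definition val_int : {pred R} := fun x => fin 0 <= v x.

Fact val_int_subring : subring_closed val_int.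
Proof.
split=> [|x y|x y]; rewrite !unfold_in.
- by rewrite val_1.
- move=> vx vy; apply: le_trans (val_D v x (- y)).
  by rewrite le_min val_N vx vy.
- move=> vx vy; rewrite val_M; apply: (le_trans vx).
  by rewrite -[leLHS]addr0; apply: winfty_leD2l.
Qed.

HB.instance Definition _ := GRing.isSubringClosed.Build R val_int
  val_int_subring.

Definition valring : Type := {x : R | x \in val_int}.

HB.instance Definition _ := SubChoice.on valring.
HB.instance Definition _ :=
  [SubChoice_isSubComNzRing of valring by <:].

End ValuationRing.

Section ValuationRingMorphism.
Variables (R S : comNzRingType) (G : oagType).
Variables (f : {rmorphism R -> S}) (v : valuation S G).

Definition valring_map (x : valring (restr_val f v)) : valring v :=
  exist _ (f (val x)) (valP x).

Fact valring_map_zmod : zmod_morphism valring_map.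
Proof. by move=> x y; apply: val_inj; rewrite /= rmorphB. Qed.
Fact valring_map_monoid : monoid_morphism valring_map.
Proof.
by split=> [|x y]; apply: val_inj; rewrite /= ?rmorph1 ?rmorphM.
Qed.

HB.instance Definition _ := GRing.isZmodMorphism.Build
  (valring (restr_val f v)) (valring v) valring_map valring_map_zmod.
HB.instance Definition _ := GRing.isMonoidMorphism.Build
  (valring (restr_val f v)) (valring v) valring_map valring_map_monoid.

End ValuationRingMorphism.

Arguments valring_map {R S G} f v x.

Definition derivation (A B : comNzRingType) (f : {rmorphism A -> B})
    (M : lmodType B) (d : B -> M) : Prop :=
  [/\ {morph d : x y / x + y},
      forall (a : A) (x : B), d (f a * x) = f a *: d x
    & forall x y : B, d (x * y) = x *: d y + y *: d x].

(* [Omega], with [d : B -> Omega], is the module of Kähler differentials of [B]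
   over [A]: the universal property determines it up to unique isomorphism. *)
Definition kaehler_differentials (A B : comNzRingType)
    (f : {rmorphism A -> B}) (Omega : lmodType B) (d : B -> Omega) : Prop :=
  derivation f d /\
  forall (M : lmodType B) (d' : B -> M), derivation f d' ->
    exists2 h : {linear Omega -> M}, h \o d =1 d' &
      forall h' : {linear Omega -> M}, h' \o d =1 d' -> h' =1 h.

Definition annihilator (B : comNzRingType) (M : lmodType B) : set B :=
  [set b : B | forall m : M, b *: m = 0]%classic.

Section QuotientModule.
Variables (R : pzRingType) (V : lmodType R) (W : submodClosed V).

(* [submodClosed] does not inherit from [zmodClosed]. *)
Definition submod_zmod : {pred V} := fun x => x \in W.

Fact submod_zmod_closed : zmod_closed submod_zmod.
Proof.
have submodE x : (x \in submod_zmod) = (x \in W) by [].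
split=> [|x y]; rewrite !submodE ?rpred0 // => Wx Wy.
by rewrite rpredD // -scaleN1r rpredZ.
Qed.

HB.instance Definition _ :=
  GRing.isZmodClosed.Build V submod_zmod submod_zmod_closed.

Definition lquot : Type := {ideal_quot submod_zmod}.

HB.instance Definition _ := GRing.Zmodule.on lquot.

Definition lquot_class (x : V) : lquot := \pi_({ideal_quot submod_zmod}) x.

Lemma lquot_classP (x y : V) :
  lquot_class x = lquot_class y <-> x - y \in W.
Proof. rewrite -[x - y \in W]/(x - y \in submod_zmod) Quotient.idealrBE.
by split=> [/eqP|/eqP]. Qed.

Definition lquot_scale (a : R) (x : lquot) : lquot :=
  lquot_class (a *: (repr (x : {ideal_quot submod_zmod}))).

Lemma lquot_classD : {morph lquot_class : x y / x + y}.
Proof. by move=> x y; rewrite /lquot_class raddfD. Qed.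

Lemma lquot_repr (x : lquot) : lquot_class (repr (x : {ideal_quot submod_zmod})) = x.
Proof. exact: reprK. Qed.

Lemma lquot_scale_class (a : R) (x : V) :
  lquot_scale a (lquot_class x) = lquot_class (a *: x).
Proof.
apply/lquot_classP; rewrite -scalerBr; apply: rpredZ; apply/lquot_classP.
exact: lquot_repr.
Qed.

Fact lquot_scalerA (a b : R) (x : lquot) :
  lquot_scale a (lquot_scale b x) = lquot_scale (a * b) x.
Proof. by rewrite -[x]lquot_repr !lquot_scale_class scalerA. Qed.

Fact lquot_scale1r : left_id 1 lquot_scale.
Proof. by move=> x; rewrite -[x]lquot_repr !lquot_scale_class scale1r. Qed.

Fact lquot_scalerDr : right_distributive lquot_scale +%R.
Proof.
move=> a x y; rewrite -[x]lquot_repr -[y]lquot_repr -lquot_classD.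
by rewrite !lquot_scale_class scalerDr lquot_classD.
Qed.

Fact lquot_scalerDl (x : lquot) :
  {morph lquot_scale^~ x : a b / a + b}.
Proof.
move=> a b; rewrite -[x]lquot_repr !lquot_scale_class scalerDl.
exact: lquot_classD.
Qed.

HB.instance Definition _ := GRing.Zmodule_isLmodule.Build R lquot
  lquot_scalerA lquot_scale1r lquot_scalerDr lquot_scalerDl.

Fact lquot_class_linear : linear lquot_class.
Proof. by move=> a x y; rewrite lquot_classD -lquot_scale_class. Qed.

HB.instance Definition _ :=
  GRing.isLinear.Build R V lquot *:%R lquot_class lquot_class_linear.

End QuotientModule.

Section SegmentModule.
Variables (L : fieldType) (G : oagType) (v : valuation L G).
Implicit Types S T : set (winfty G).

(* [b = 0] is implied by the second disjunct unless [S] is empty. *)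
Definition segment S : {pred L} :=
  fun b => `[< b = 0 \/ exists2 s, S s & s <= v b >].

Fact segment_zmod S : zmod_closed (segment S).
Proof.
split=> [|x y]; rewrite !unfold_in; first by apply/asboolP; left.
move=> /asboolP[->|[s Ss sx]] /asboolP[->|[t St ty]]; apply/asboolP.
- by left; rewrite subr0.
- by right; exists t => //; rewrite sub0r val_N.
- by right; exists s => //; rewrite subr0.
right; have := val_D v x (- y); rewrite val_N => xy.
case/orP: (winfty_le_total s t) => st.
  exists s => //; apply: le_trans xy; rewrite le_min sx.
  exact: le_trans ty.
exists t => //; apply: le_trans xy; rewrite le_min ty andbT.
exact: le_trans sx.
Qed.

HB.instance Definition _ S :=
  GRing.isZmodClosed.Build L (segment S) (segment_zmod S).

Fact segment_scale S (a : valring v) (b : L) :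
  b \in segment S -> val a * b \in segment S.
Proof.
rewrite !unfold_in => /asboolP[->|[s Ss sb]]; apply/asboolP.
  by left; rewrite mulr0.
right; exists s => //; rewrite val_M; apply: (le_trans sb).
rewrite -[leLHS]add0r addrC [leRHS]addrC; apply: winfty_leD2l.
exact: (valP a).
Qed.

Definition segmod S : Type := {b : L | b \in segment S}.

HB.instance Definition _ S := SubChoice.on (segmod S).
HB.instance Definition _ S := [SubChoice_isSubZmodule of segmod S by <:].

Definition segmod_scale S (a : valring v) (b : segmod S) : segmod S :=
  exist _ (val a * val b) (segment_scale a (valP b)).

Fact segmod_scalerA S a b (x : segmod S) :
  segmod_scale a (segmod_scale b x) = segmod_scale (a * b) x.
Proof. by apply: val_inj; rewrite /= mulrA. Qed.

Fact segmod_scale1r S : left_id 1 (@segmod_scale S).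
Proof. by move=> x; apply: val_inj; rewrite /= mul1r. Qed.

Fact segmod_scalerDr S : right_distributive (@segmod_scale S) +%R.
Proof. by move=> a x y; apply: val_inj; rewrite /= mulrDr. Qed.

Fact segmod_scalerDl S (x : segmod S) :
  {morph (@segmod_scale S)^~ x : a b / a + b}.
Proof. by move=> a b; apply: val_inj; rewrite /= mulrDl. Qed.

HB.instance Definition _ S :=
  GRing.Zmodule_isLmodule.Build (valring v) (segmod S)
    (@segmod_scalerA S) (@segmod_scale1r S)
    (@segmod_scalerDr S) (@segmod_scalerDl S).

Definition subsegment S T : {pred segmod S} := fun b => val b \in segment T.

Fact subsegment_submod S T : submod_closed (@subsegment S T).
Proof.
have subE x : (x \in @subsegment S T) = (val x \in segment T) by [].
split=> [|a x y]; rewrite !subE; first exact: rpred0.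
by move=> Tx Ty; apply: rpredD => //; apply: segment_scale.
Qed.

HB.instance Definition _ S T :=
  GRing.isSubmodClosed.Build (valring v) (segmod S) (@subsegment S T)
    (@subsegment_submod S T).

(* [I_S / I_T]; when [I_T] is not contained in [I_S], it is read as
   [I_S / (I_S `&` I_T)], the image of [I_S] in [L / I_T]. *)
Definition segquot S T : lmodType (valring v) := lquot (@subsegment S T).

Definition segquot_class S T (b : L) (Sb : b \in segment S) : segquot S T :=
  lquot_class (@subsegment S T) (exist _ b Sb).

End SegmentModule.

Section Truncation.
Variables (K : fieldType) (G : oagType) (nu : {poly K} -> winfty G).
Implicit Types q f : {poly K}.

(* The coefficient of [q ^+ l] in the [q]-expansion of [f]. *)
Definition expansion_coef q f (l : nat) : {poly K} := (f %/ q ^+ l) %% q.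

Lemma expansion_coefE q f : (1 < size q)%N ->
  f = \sum_(l < size f) expansion_coef q f l * q ^+ l /\
  forall l, (size (expansion_coef q f l) < size q)%N.
Proof.
move=> q1; have q0 : q != 0 by rewrite -size_poly_gt0 ltnW.
split=> [|l]; last by rewrite ltn_modp.
have step n :
    f = (f %/ q ^+ n) * q ^+ n + \sum_(l < n) expansion_coef q f l * q ^+ l.
  elim: n => [|n IHn]; first by rewrite big_ord0 expr0 divp1 mulr1 addr0.
  rewrite {1}IHn big_ord_recr /= [X in _ = _ + X]addrC addrA; congr (_ + _).
  rewrite exprS mulrA -mulrDl; congr (_ * _).
  by rewrite [q * _]mulrC -divp_divl; apply: divp_eq.
rewrite {1}(step (size f)) divp_small ?mul0r ?add0r //.
rewrite (polySpred (expf_neq0 _ q0)) size_exp ltnS leq_pmull //.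
by rewrite -ltnS prednK // ltnW.
Qed.

Definition truncation q f : winfty G :=
  \big[Order.min/infty]_(l < size f) nu (expansion_coef q f l * q ^+ l).

Definition complete_set (S : set {poly K}) : Prop :=
  (forall q, S q -> (1 < size q)%N) /\
  forall f, (1 < size f)%N ->
    exists2 q, S q & (size q <= size f)%N /\ truncation q f = nu f.

End Truncation.

Section KeyPolynomials.
Variables (K : fieldType) (Kbar : closedFieldType).
Variables (iota : {rmorphism K -> Kbar}) (G : oagType).
Variable mu : {poly Kbar} -> winfty G.
Implicit Types f Q : {poly K}.

(* The roots of [f] in [Kbar], listed with multiplicities. *)
Definition roots f : seq Kbar :=
  sval (closed_field_poly_normal (map_poly iota f)).

(* The head of the nonempty list [s] is the neutral default of the maximum; see
   [deltaP]. *)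
Definition delta f : winfty G :=
  let s := [seq mu ('X - a%:P) | a <- roots f] in
  \big[Order.max/head infty s]_(c <- s) c.

Definition key_polynomial Q : Prop :=
  [/\ Q \is monic, (1 < size Q)%N &
      forall f, (1 < size f)%N -> delta Q <= delta f -> (size Q <= size f)%N].

Lemma mem_roots f a : f != 0 -> (a \in roots f) = root (map_poly iota f) a.
Proof.
move=> f0; rewrite /roots; case: closed_field_poly_normal => r /= fr.
by rewrite fr rootZ ?root_prod_XsubC // lead_coef_eq0 map_poly_eq0.
Qed.

Fact big_max_ub (c0 : winfty G) (s : seq (winfty G)) (c : winfty G) :
  c \in s -> c <= \big[Order.max/c0]_(c <- s) c.
Proof.
elim: s => // c1 s IHs; rewrite inE big_cons le_max.
by case/predU1P => [->|/IHs ->]; rewrite ?lexx ?orbT.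
Qed.

Lemma deltaP f : (1 < size f)%N ->
  (exists2 a, root (map_poly iota f) a & delta f = mu ('X - a%:P)) /\
  forall a, root (map_poly iota f) a -> mu ('X - a%:P) <= delta f.
Proof.
move=> f1; have f0 : f != 0 by rewrite -size_poly_gt0 ltnW.
have [b fb] : exists b, root (map_poly iota f) b.
  by apply/closed_rootP; rewrite size_map_poly gtn_eqF.
have := mem_roots _ f0; rewrite /delta; case: (roots f) => [|a0 r] fr.
  by have := fr b; rewrite fb.
split=> [|a].
  rewrite /=.
  have : (\big[Order.max/mu ('X - a0%:P)]_(c <- [seq mu ('X - a%:P) |
       a <- a0 :: r]) c) \in [seq mu ('X - a%:P) | a <- a0 :: r].
    set s := map _ _; have sa0 : mu ('X - a0%:P) \in s by apply: mem_head.
    rewrite big_seq; elim/big_ind: _ => // x y sx sy.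
    by rewrite maxEle; case: ifP.
  by case/mapP => a ar ->; exists a => //; rewrite -fr.
rewrite -fr => /(map_f (fun a => mu ('X - a%:P))) /=.
exact: (@big_max_ub _ (mu ('X - a0%:P) :: [seq mu ('X - b%:P) | b <- r])).
Qed.

End KeyPolynomials.

Record valuation_extension (K : fieldType) (Kbar : closedFieldType)
    (iota : {rmorphism K -> Kbar}) (G G' : oagType) (e : {additive G -> G'})
    (nu : valuation {poly K} G) (mu : valuation {poly Kbar} G') : Prop :=
  ValuationExtension {
    ext_order : {mono e : x y / x <= y};
    ext_val : forall f : {poly K}, mu (map_poly iota f) = omap e (nu f)
  }.

Record complete_key_sequence (K : fieldType) (Kbar : closedFieldType)
    (iota : {rmorphism K -> Kbar}) (G G' : oagType)
    (nu : {poly K} -> winfty G) (mu : {poly Kbar} -> winfty G')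
    (g : {poly K}) (disp : Order.disp_t) (I : orderType disp) (i0 : I)
    (Q : I -> {poly K}) : Prop := CompleteKeySequence {
  cks_key : forall q, (range Q `|` [set g])%classic q -> key_polynomial iota mu q;
  cks_complete : complete_set nu (range Q `|` [set g])%classic;
  cks_wo : well_order (<=%O : rel I);
  cks_init : forall i : I, (i0 <= i)%O;
  cks_delta : forall i j : I, (i < j)%O ->
    delta iota mu (Q i) < delta iota mu (Q j);
  cks_fin : forall i : I, nu (Q i) < infty;
  cks_X : Q i0 = 'X;
  cks_nuX : nu 'X = fin 0
}.

Section Setting.
Variables (K : fieldType) (L : fieldExtType K) (G : oagType).
Variables (v : valuation L G) (eta : L) (g : {poly K}).

Definition base_val : valuation K G := restr_val (in_alg L) v.

Definition eval_val : valuation {poly K} G := restr_val (horner_alg eta) v.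

Local Notation nu := eval_val.

Section Segments.
Variables (I : Type) (Q : I -> {poly K}).

Definition alpha_at (i : I) : winfty G :=
  winfty_sub (nu (Q i)^`()) (nu (Q i)).

Definition beta_at (i : I) : winfty G :=
  winfty_sub (nu g^`()) (truncation nu (Q i) g).

Definition alpha : set (winfty G) :=
  smallest (@final_segment G) (range alpha_at).

Definition beta : set (winfty G) :=
  smallest (@final_segment G) (range beta_at).

Definition gamma : set G :=
  [set c : G | [set (fin c : winfty G) + s | s in alpha] `<=` beta]%classic.

Variables (a : I -> K).
Hypothesis nuQ_fin : forall i, nu (Q i) < infty.
Hypothesis val_a : forall i, base_val (a i) = nu (Q i).

Fact val_div_eta (f : {poly K}) (i : I) :
  v (horner_alg eta f / (a i)%:A) = winfty_sub (nu f) (nu (Q i)).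
Proof.
have a0 : (a i)%:A != 0 :> L.
  apply/eqP => /(val_eqinfty v) va; have := nuQ_fin i.
  by rewrite -val_a /base_val /= va ltxx.
rewrite -val_a /=; have := val_M v (horner_alg eta f / (a i)%:A) (a i)%:A.
rewrite divfK // => ->; have /eqP := a0.
case: (v (a i)%:A) (val_eqinfty v (a i)%:A) => [c _|[+ _]].
  by case: (v (_ / _)) => //= b; rewrite addrK.
by move=> /(_ erefl).
Qed.

Fact tilde_eta_int (i : I) : horner_alg eta ((a i)^-1 *: Q i) \in val_int v.
Proof.
have -> : horner_alg eta ((a i)^-1 *: Q i) =
    horner_alg eta (Q i) / (a i)%:A.
  by rewrite linearZ -[(a i)%:A]/(in_alg L (a i)) -fmorphV /= mulrC.
change (fin 0 <= v (horner_alg eta (Q i) / (a i)%:A)).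
rewrite val_div_eta winfty_leE.
by case: (nu (Q i)) => [c|] //=; rewrite subrr.
Qed.

Definition tilde_eta (i : I) : valring v :=
  exist _ (horner_alg eta ((a i)^-1 *: Q i)) (tilde_eta_int i).

Fact deriv_eta_alpha (i : I) :
  horner_alg eta (Q i)^`() / (a i)%:A \in segment v alpha.
Proof.
apply/asboolP; right; exists (alpha_at i).
  by apply: sub_gen_smallest; exists i.
by rewrite val_div_eta.
Qed.

Definition deriv_eta_class (i : I) : segquot v alpha beta :=
  segquot_class beta (deriv_eta_alpha i).

End Segments.

End Setting.

(* Main.v *)
Require Import Defs.
From HB Require Import structures.
From mathcomp Require Import all_boot all_order all_algebra all_field.
From mathcomp Require Import boolp classical_sets wochoice.

Set Implicit Arguments.
Unset Strict Implicit.
Unset Printing Implicit Defensive.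

Import Order.TTheory GRing.Theory Num.Theory.
Local Open Scope ring_scope.
Local Open Scope classical_set_scope.

(** Annihilators are invariant under isomorphism, so the isomorphism
    [phi : Omega -> I_alpha / I_beta] reduces the claim to the annihilator of
    [I_alpha / I_beta], which consists of the integral [b] with
    [b I_alpha] contained in [I_beta] ([annihilator_segquot]).

    Since [alpha] and [beta] are final segments containing [infty] (the index
    set has an initial element), membership of [x] in [I_alpha] or [I_beta] is
    just membership of [v x] in [alpha] or [beta] ([segment_final]).  As every
    element of the value group is the value of some [x] in [L], for [b != 0] the
    condition above says that translation by [v b] maps [alpha] into [beta]
    ([mul_segment_sub]), that is, that [v b] lies in [gamma].  Finally [gamma]
    is itself a final segment, because [beta] is, so [v b] lies in [gamma] as
    soon as [v b] dominates an element of [gamma], i.e. as soon as [b] lies in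
    [I_gamma].  For [b = 0] both sides hold trivially. *)

Lemma annihilator_bij (B : comNzRingType) (M N : lmodType B)
    (phi : {linear M -> N}) :
  bijective phi -> annihilator M = annihilator N.
Proof.
move=> phi_bij; have [psi phiK psiK] := phi_bij.
apply/seteqP; split=> b annb m.
  by rewrite -[m]psiK -linearZZ annb linear0.
by apply: (bij_inj phi_bij); rewrite linearZZ annb linear0.
Qed.

Section FinalSegments.
Variables (L : fieldType) (G : oagType) (v : valuation L G).
Implicit Types S T X : set (winfty G).

Lemma annihilator_segquot S T (b : valring v) :
  annihilator (segquot v S T) b <->
  forall x, x \in segment v S -> val b * x \in segment v T.
Proof.
have class0 (y : segmod v S) :
    lquot_class (@subsegment _ _ v S T) y = 0 <-> val y \in segment v T.
  rewrite -[0](linear0 (lquot_class (@subsegment _ _ v S T))).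
  split=> [/lquot_classP|Ty]; first by rewrite subr0.
  by apply/lquot_classP; rewrite subr0.
split=> [annb x Sx|bST m].
  have /(_ (lquot_class (@subsegment _ _ v S T) (exist _ x Sx))) := annb.
  by rewrite -linearZZ => /class0.
rewrite -[m]lquot_repr -linearZZ; apply/class0; apply: bST.
exact: (valP (repr (m : {ideal_quot _}))).
Qed.

(** [I_S] always contains [0], whose value is [infty], whence [S infty]. *)
Lemma segment_final S (x : L) :
  final_segment S -> S infty -> x \in segment v S <-> S (v x).
Proof.
move=> finS Soo; split=> [/asboolP[->|[s Ss sx]]|Sx].
- by rewrite val_0.
- exact: finS Ss sx.
by apply/asboolP; right; exists (v x).
Qed.

Lemma final_smallest X : final_segment (smallest (@final_segment G) X).
Proof. by move=> s t Xs st S [finS XS]; apply: (finS _ _ _ st); apply: Xs. Qed.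

Lemma smallest_infty X (s : winfty G) :
  X s -> smallest (@final_segment G) X infty.
Proof.
move=> Xs; have Ss : smallest (@final_segment G) X s by exact: sub_gen_smallest.
by apply: (final_smallest Ss); case: (s).
Qed.

(** Every finite [s] in [S] is the value of an element of [I_S], as [v] is onto
    the group, and [infty] is carried to itself. *)
Lemma mul_segment_sub S T (b : L) :
    value_group v = [set: G] ->
    final_segment S -> S infty -> final_segment T -> T infty ->
  (forall x, x \in segment v S -> b * x \in segment v T) <->
  (forall s, S s -> T (v b + s)).
Proof.
move=> vL finS Soo finT Too; split=> [bST [s|] Ss|bST x].
- have [x vx] : value_group v s by rewrite vL.
  rewrite -vx -val_M; apply/segment_final => //; apply: bST.
  by apply/segment_final => //; rewrite vx.
- by case: (v b).
move=> /segment_final Sx; apply/segment_final => //.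
by rewrite val_M; apply: bST; apply: Sx.
Qed.

(** The translations carrying [S] into [T] themselves form a final segment of
    the group, since [T] is final, so dominating one of them amounts to being
    one.  There may be none, and then only [b = 0] lies in the left-hand
    module; its value [infty] may still carry [S] into [T], whence [b != 0]. *)
Lemma segment_translators S T (b : L) :
    final_segment T -> b != 0 ->
  b \in segment v
    [set fin c |
      c in [set c : G | [set (fin c : winfty G) + s | s in S] `<=` T]]
  <-> (forall s, S s -> T (v b + s)).
Proof.
move=> finT b0; split=> [/asboolP[bz|[_ [c cST <-] cb] s Ss]|bST].
- by rewrite bz eqxx in b0.
- apply: (finT (fin c + s)); first by apply: cST; exists s.
  by rewrite addrC [leRHS]addrC; apply: winfty_leD2l.
apply/asboolP; right; case vb: (v b) => [c|].
  by exists (fin c) => //; exists c => // _ [s Ss <-]; rewrite -vb; apply: bST.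
by move/val_eqinfty: vb b0 => ->; rewrite eqxx.
Qed.

End FinalSegments.

Theorem proposition4p4
    (K : fieldType) (L : fieldExtType K) (G : oagType) (v : valuation L G)
    (vL : value_group v = [set: G])
    (vLK : value_group v = value_group (base_val v))
    (eta : L) (L_eta : <<1; eta>>%VS = fullv)
    (g : {poly K}) (g_min : map_poly (in_alg L) g = minPoly 1 eta)
    (Kbar : closedFieldType) (iota : {rmorphism K -> Kbar})
    (Kbar_alg : forall z : Kbar, algebraicOver iota z)
    (G' : oagType) (e : {additive G -> G'}) (mu : valuation {poly Kbar} G')
    (mu_ext : valuation_extension iota e (eval_val v eta) mu)
    (disp : Order.disp_t) (I : orderType disp) (i0 : I) (Q : I -> {poly K})
    (Q_cks : complete_key_sequence iota (eval_val v eta) mu g i0 Q)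
    (a : I -> K) (val_a : forall i, base_val v (a i) = eval_val v eta (Q i))
    (a_i0 : a i0 = 1)
    (Omega : lmodType (valring v)) (d : valring v -> Omega)
    (Omega_d : kaehler_differentials (valring_map (in_alg L) v) d)
    (phi : {linear Omega -> segquot v (alpha v eta Q) (beta v eta g Q)})
    (phi_d : forall i,
       phi (d (tilde_eta (cks_fin Q_cks) val_a i)) =
       deriv_eta_class g (cks_fin Q_cks) val_a i)
    (phi_iso : bijective phi) :
  [set val b | b in annihilator Omega] =
  [set b : L | b \in segment v [set fin c | c in gamma v eta g Q]] `&`
  [set b : L | b \in val_int v].
Proof.
have finA : final_segment (alpha v eta Q) by exact: final_smallest.
have finB : final_segment (beta v eta g Q) by exact: final_smallest.
have Aoo : alpha v eta Q infty.
  by apply: (smallest_infty (s := alpha_at v eta Q i0)); exists i0.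
have Boo : beta v eta g Q infty.
  by apply: (smallest_infty (s := beta_at v eta g Q i0)); exists i0.
have annE (b : valring v) : annihilator Omega b <->
    val b \in segment v [set fin c | c in gamma v eta g Q].
  rewrite (annihilator_bij phi_iso).
  apply: (iff_trans (annihilator_segquot _ _ _)).
  have [->|b0] := eqVneq (val b) 0.
    by split=> [_|_ x _]; rewrite ?mul0r rpred0.
  apply: (iff_trans (mul_segment_sub _ vL finA Aoo finB Boo)).
  exact: iff_sym (segment_translators _ _ finB b0).
apply/seteqP; split=> [_ [b /annE bg <-]|b [bg b_int]].
  by split=> //; apply: (valP b).
by exists (exist _ b b_int) => //; apply/annE.
Qed.
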